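(* Consider the general estimator-selection framework and the notation $p_2$, $\delta$, $\widehat m^{(0)}_{\min}(C)$ of the context. (i) Let $\varepsilon_\delta\in[0,1]$, $\varepsilon'_\delta\ge0$, and assume that for every $m\in\mathcal M$, $\mathrm{pen}_0(m)=p_2(m)$, and that $$\forall m,m'\in\mathcal M,\quad|\delta(m)-\delta(m')|\le\varepsilon_\delta\left[\mathcal R(s^\star_m)-\mathcal R(s^\star)+\mathcal R(s^\star_{m'})-\mathcal R(s^\star)\right]+\varepsilon'_\delta.\qquad(\ast)$$ Then, for every $C\in[0,1)$, $$p_2\left(\widehat m^{(0)}_{\min}(C)\right)\ge\sup_{m\in\mathcal M}\left\{p_2(m)-\frac2{1-C}\left[\mathcal R(s^\star_m)-\mathcal R(s^\star)\right]\right\}-\frac{\varepsilon'_\delta}{1-C},$$ and if $\mathcal R(s^\star_{m_1})=\mathcal R(s^\star)$ for some $m_1\in\mathcal M$ with $p_2(m_1)>0$, then for any $\alpha\in(0,1)$, setting $\eta_\alpha=\frac{\varepsilon'_\delta}{\alpha\,p_2(m_1)}$, $$\forall C\in[0,1)\text{ with }C\le1-\eta_\alpha,\quad p_2\left(\widehat m^{(0)}_{\min}(C)\right)\ge(1-\alpha)\,p_2(m_1).$$ (ii) Assume that the data $\xi_1,\dots,\xi_n\in\Xi$ are i.i.d. and that there exist a contrast function $\gamma:\Xi\times\mathbb S\to\mathbb R$ and constants $A,L>0$ such that $$\forall t\in\mathbb S,\quad\widehat{\mathcal R}_n(t)=\frac1n\sum_{i=1}^n\gamma(\xi_i,t)\quad\text{and}\quad\mathcal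 R(t)=\mathbb E[\widehat{\mathcal R}_n(t)]=\mathbb E[\gamma(\xi_1,t)],$$ $$\forall t\in\mathbb S,\quad|\gamma(\xi_1,t)|\le A\ \text{ almost surely},$$ $$\forall m\in\mathcal M,\quad\operatorname{var}\left(\gamma(\xi_1,s^\star_m)-\gamma(\xi_1,s^\star)\right)\le L\left[\mathcal R(s^\star_m)-\mathcal R(s^\star)\right].$$ Then, for every $x\ge0$, with probability at least $1-2\,\mathrm{card}(\mathcal M)e^{-x}$, for any $\theta>0$, the inequality $(\ast)$ holds true with $$\varepsilon_\delta=\theta\quad\text{and}\quad\varepsilon'_\delta=\left(\frac L\theta+\frac{4A}3\right)\frac xn.$$
   Context: General framework: $\mathbb S$ is a set, $\mathcal R:\mathbb S\to[0,+\infty)$ is a risk function, and $\widehat{\mathcal R}_n:\mathbb S\to[0,+\infty)$ is the associated (random, data-dependent) empirical risk, satisfying $\mathbb E[\widehat{\mathcal R}_n(t)]=\mathcal R(t)$ for every $t\in\mathbb S$. $s^\star\in\mathbb S$ is such that $\mathcal R(s^\star)=\inf_{t\in\mathbb S}\mathcal R(t)$. $\mathcal M$ is a finite index set, $(\widehat s_m)_{m\in\mathcal M}$ is a collection of estimators (random, data-dependent elements of $\mathbb S$), and for each $m\in\mathcal M$, $s^\star_m$ is a fixed deterministic element of $\mathbb S$ (e.g. a minimizer of $\mathcal R$ over a model when $\widehat s_m$ is an empirical risk minimizer over that model). Define $$p_2(m)=\widehat{\mathcal R}_n(s^\star_m)-\widehat{\mathcal R}_n(\widehat s_m),\qquad\delta(m)=\mathcal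 R(s^\star_m)-\widehat{\mathcal R}_n(s^\star_m).$$ Given a penalty $\mathrm{pen}_0:\mathcal M\to\mathbb R$ (possibly data-dependent), for every $C\ge0$, $$\widehat m^{(0)}_{\min}(C)\in\operatorname*{argmin}_{m\in\mathcal M}\left\{\widehat{\mathcal R}_n(\widehat s_m)+C\,\mathrm{pen}_0(m)\right\}.$$ Part (i) is a deterministic statement, valid for each realization of the data for which its assumptions hold. *)

(* Defs.v *)
From HB Require Import structures.
From mathcomp Require Import all_boot all_order all_algebra.
From mathcomp Require Import all_classical all_reals all_analysis.

Set Implicit Arguments.
Unset Strict Implicit.
Unset Printing Implicit Defensive.

Import Order.TTheory GRing.Theory Num.Theory.
Import numFieldNormedType.Exports.

Local Open Scope classical_set_scope.
Local Open Scope ring_scope.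

(* A point w : Omega is a realization of all the
   randomness, so a data-dependent object is a function of w. *)

Definition argmin (T : Type) (R : realType) (f : T -> R) : set T :=
  [set m | forall m', f m <= f m'].

Definition p2 (R : realType) (Omega S M : Type) (Rn : S -> Omega -> R)
    (sm : M -> S) (shat : M -> Omega -> S) (w : Omega) (m : M) : R :=
  Rn (sm m) w - Rn (shat m w) w.

Definition delta (R : realType) (Omega S M : Type) (Risk : S -> R)
    (Rn : S -> Omega -> R) (sm : M -> S) (w : Omega) (m : M) : R :=
  Risk (sm m) - Rn (sm m) w.

(* Condition on the increments of delta, at the realization w, with constants
   eps = epsilon_delta and eps' = epsilon'_delta. *)
Definition delta_increments_bound (R : realType) (Omega S M : Type)
    (Risk : S -> R) (Rn : S -> Omega -> R) (sstar : S) (sm : M -> S)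
    (w : Omega) (eps eps' : R) : Prop :=
  forall m m' : M,
    `| delta Risk Rn sm w m - delta Risk Rn sm w m' |
    <= eps * ((Risk (sm m) - Risk sstar) + (Risk (sm m') - Risk sstar)) + eps'.

(* Stated through a measurable event E on which Q holds, so that no value of P
   on a possibly non-measurable set is involved. *)
Definition with_probability_at_least (d : measure_display)
    (Omega : measurableType d) (R : realType) (P : probability Omega R)
    (q : R) (Q : Omega -> Prop) : Prop :=
  exists E : set Omega,
    [/\ measurable E, (q%:E <= P E)%E & forall w, E w -> Q w].

(* Mutual independence: product rule over every finite subfamily J. *)
Definition mutually_independent (d d' : measure_display)
    (Omega : measurableType d) (Xi : measurableType d') (R : realType)
    (P : probability Omega R) (n : nat) (xi : 'I_n -> {RV P >-> Xi}) : Prop :=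
  forall (J : {set 'I_n}) (B : 'I_n -> set Xi),
    (forall i, i \in J -> measurable (B i)) ->
    (P (\bigcap_(i in [set` J]) (xi i @^-1` B i))
     = \prod_(i in J) P (xi i @^-1` B i))%E.

Definition identically_distributed (d d' : measure_display)
    (Omega : measurableType d) (Xi : measurableType d') (R : realType)
    (P : probability Omega R) (n : nat) (xi : 'I_n -> {RV P >-> Xi}) : Prop :=
  forall (i j : 'I_n) (B : set Xi), measurable B ->
    distribution P (xi i) B = distribution P (xi j) B.

Definition iid (d d' : measure_display)
    (Omega : measurableType d) (Xi : measurableType d') (R : realType)
    (P : probability Omega R) (n : nat) (xi : 'I_n -> {RV P >-> Xi}) : Prop :=
  mutually_independent xi /\ identically_distributed xi.

(* Main.v *)
Require Import Defs.
From HB Require Import structures.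
From mathcomp Require Import all_boot all_order all_algebra.
From mathcomp Require Import all_classical all_reals all_analysis.
From mathcomp Require Import finmap measurable_realfun ring lra.

Set Implicit Arguments.
Unset Strict Implicit.
Unset Printing Implicit Defensive.

Import Order.TTheory GRing.Theory Num.Theory.
Import numFieldNormedType.Exports HBNNSimple.

Local Open Scope classical_set_scope.
Local Open Scope ring_scope.

(** Part (i) is deterministic. When the penalty is [p2], the criterion minimized
    by [mhat C] is [Rn (sm m) - (1 - C) * p2 m], that is,
    [Risk (sm m) - delta m - (1 - C) * p2 m]. Comparing its values at the
    minimizer and at any other [m], the bound on the increments of [delta] costs
    at most [eps] times the two excess risks, and [eps <= 1] lets the excess risk
    of the minimizer absorb its own share ([p2_argmin_ge]). Dividing by [1 - C]
    gives both claims.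

    Part (ii) is a union bound over [M] of two-sided Bernstein inequalities for
    the centred variables
    [gamma (xi i) (sm m) - gamma (xi i) sstar - (Risk (sm m) - Risk sstar)]:
    [delta m - delta m'] is, up to sign, the difference of their empirical means
    for [m] and [m'].  The square root in Bernstein's bound is split by
    [2 * sqrt (a * b) <= a + b], with weights depending on [theta]; since the
    good event does not involve [theta], the conclusion holds for all [theta]
    simultaneously.

    The constant [4 * A / 3] requires the centred variables to be bounded by
    [2 * A], while [|gamma| <= A] alone only yields [4 * A].  The gain comes from
    the nonnegativity of the empirical risk: were [gamma (xi i) t < 0] with
    positive probability, independence would make all [n] terms negative at once
    on a nonempty event.  Hence [0 <= gamma (xi i) t <= A] almost surely
    ([ae_nonneg_of_sum_nonneg]), and a difference of two such variables, as well
    as the difference of their means, lies in [[-A, A]].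

    Bernstein's inequality ([bernstein_iid]) is Chernoff's bound.  Independence
    is a product rule on events, so the expectation of a product of functions of
    the [xi i] is computed by extending that rule from indicators to nonnegative
    functions, one variable at a time ([expectation_prod_independent]).  The
    moment generating function of one variable is controlled by a quadratic
    majorant of the exponential ([expR_le_quadratic]). *)

(** * Expectation of a product of independent variables *)

Lemma measurable_preimage (d d' : measure_display)
    (Omega : measurableType d) (Xi : measurableType d') (R : realType)
    (P : probability Omega R) (X : {RV P >-> Xi}) (B : set Xi) :
  measurable B -> measurable (X @^-1` B).
Proof.
move=> mB; rewrite -[X in measurable X]setTI; exact: (measurable_funPT X).
Qed.

Lemma integral_indic_comp (d d' : measure_display)
    (Omega : measurableType d) (Xi : measurableType d') (R : realType)
    (P : probability Omega R) (X : {RV P >-> Xi}) (B : set Xi) :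
  measurable B -> (\int[P]_w (\1_B (X w))%:E = P (X @^-1` B))%E.
Proof.
move=> mB; rewrite -[in RHS](setIT (X @^-1` B)) -(integral_indic P measurableT)//.
exact: measurable_preimage.
Qed.

(** Both sides are monotone continuous and linear in [f], so the identity on
    indicators extends to simple functions and then to all nonnegative [f].  It
    expresses that the weight [G] is independent of [X], [c] being the mean of
    [G]. *)
Lemma integral_weighted_comp (d d' : measure_display)
    (Omega : measurableType d) (Xi : measurableType d') (R : realType)
    (P : probability Omega R) (X : {RV P >-> Xi}) (G : Omega -> R) (c : \bar R)
    (f : Xi -> R) :
  measurable_fun setT G -> (forall w, 0 <= G w) -> c \is a fin_num ->
  (forall B, measurable B ->
    (\int[P]_w (G w * \1_B (X w))%:E = c * P (X @^-1` B))%E) ->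
  measurable_fun setT f -> (forall z, 0 <= f z) ->
  (\int[P]_w (G w * f (X w))%:E = c * \int[P]_w (f (X w))%:E)%E.
Proof.
move=> mG G0 cfin GB mf f0.
have mX (g : Xi -> R) : measurable_fun setT g -> measurable_fun setT (g \o X).
  by move=> mg; apply: measurableT_comp => //; exact: measurable_funPT.
have mGX (g : Xi -> R) : measurable_fun setT g ->
    measurable_fun [set: Omega] (fun w => (G w * g (X w))%:E).
  by move=> mg; apply/measurable_EFinP/measurable_funM => //; exact: mX.
have simple (s : {nnsfun Xi >-> R}) :
    (\int[P]_w (G w * s (X w))%:E = c * \int[P]_w (s (X w))%:E)%E.
  pose J := 'I_(#|` fset_set (range s)|).
  pose y (i : J) : R := (fset_set (range s))`_i.
  have y0 i : 0 <= y i.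
    have : y i \in fset_set (range s) by rewrite mem_nth.
    rewrite in_fset_set; last exact: fimfunP.
    by move=> /set_mem[z _ <-]; exact: fun_ge0.
  pose B i := s @^-1` [set y i].
  have mB i : measurable (B i) by exact: measurable_sfunP.
  have sE z : s z = \sum_(i : J) y i * \1_(B i) z by rewrite fimfunEord.
  have mind i : measurable_fun setT (\1_(B i) : Xi -> R).
    exact: measurable_indic.
  transitivity (\int[P]_w \sum_(i : J) ((y i)%:E * (G w * \1_(B i) (X w))%:E))%E.
    apply: eq_integral => w _; rewrite sE mulr_sumr -sumEFin.
    by apply: eq_bigr => i _; rewrite -EFinM mulrCA.
  rewrite ge0_integral_sum//; last 2 first.
  - by move=> i; apply: measurable_funeM; exact: mGX.
  - by move=> i w _; rewrite lee_fin !mulr_ge0.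
  transitivity (\sum_(i : J) ((y i)%:E * (c * P (X @^-1` B i))))%E.
    apply: eq_bigr => i _; rewrite ge0_integralZl ?lee_fin ?GB//; first exact: mGX.
    by move=> w _; rewrite lee_fin !mulr_ge0.
  transitivity (c * \int[P]_w
      \sum_(i : J) ((y i)%:E * (\1_(B i) (X w))%:E))%E; last first.
    congr (_ * _)%E; apply: eq_integral => w _; rewrite sE -sumEFin.
    by apply: eq_bigr => i _; rewrite -EFinM.
  have mindX i : measurable_fun [set: Omega] (fun w => (\1_(B i) (X w) : R)%:E).
    by apply/measurable_EFinP; exact: mX (mind i).
  rewrite ge0_integral_sum//; last 2 first.
  - by move=> i; apply: measurable_funeM; exact: mindX.
  - by move=> i w _; rewrite lee_fin mulr_ge0.
  rewrite ge0_sume_distrr; last first.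
    move=> i _; apply: integral_ge0 => w _.
    by rewrite lee_fin mulr_ge0.
  apply: eq_bigr => i _; rewrite ge0_integralZl ?lee_fin// muleCA.
  by congr (_ * (_ * _))%E; rewrite integral_indic_comp.
have mfE : measurable_fun [set: Xi] (EFin \o f) by exact/measurable_EFinP.
pose s k := nnsfun_approx measurableT mfE k.
have s_cvg z : EFin \o s ^~ z @ \oo --> (f z)%:E.
  by apply: cvg_nnsfun_approx => // t _; rewrite lee_fin.
have s_nd z : {homo s ^~ z : n m / (n <= m)%N >-> n <= m}.
  by move=> n m nm; exact/lefP/nd_nnsfun_approx.
have cvg_weighted (H : Omega -> R) : (forall w, 0 <= H w) ->
    measurable_fun setT H ->
    (\int[P]_w (H w * s k (X w))%:E)%E @[k --> \oo]
      --> (\int[P]_w (H w * f (X w))%:E)%E.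
  move=> H0 mH.
  rewrite [X in _ --> X](_ : _ =
      (\int[P]_w limn (fun k => (H w * s k (X w))%:E))%E); last first.
    apply: eq_integral => w _; apply/esym/cvg_lim => //.
    under eq_fun do rewrite EFinM.
    by rewrite EFinM; apply: cvgeZl => //; exact: s_cvg.
  apply: (cvg_monotone_convergence measurableT
    (g' := fun k w => (H w * s k (X w))%:E)) => //.
  - by move=> k; apply/measurable_EFinP/measurable_funM => //; exact: mX.
  - by move=> k w _; rewrite lee_fin mulr_ge0.
  - by move=> w _ n m nm; rewrite lee_fin ler_wpM2l// s_nd.
have cvg1 := cvg_weighted G G0 mG.
have cvg2 : (c * \int[P]_w (s k (X w))%:E)%E @[k --> \oo]
    --> (c * \int[P]_w (f (X w))%:E)%E.
  apply: cvgeZl => //.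
  have := cvg_weighted (cst 1) (fun=> ler01) (measurable_cst _).
  rewrite (_ : (fun k => _) = (fun k => \int[P]_w (s k (X w))%:E)%E); last first.
    by apply/funext => k; apply: eq_integral => w _; rewrite mul1r.
  by under eq_integral do rewrite mul1r.
move: cvg1; under eq_fun do rewrite simple.
by move=> cvg1; apply: (cvg_unique _ cvg1 cvg2).
Qed.

(** Independence is the case where every factor is an indicator.  The induction is
    on the list of indices whose factor is allowed to be a general function:
    releasing one more index is [integral_weighted_comp], the weight being the
    product of all the other factors. *)
Lemma expectation_prod_independent (d d' : measure_display)
    (Omega : measurableType d) (Xi : measurableType d') (R : realType)
    (P : probability Omega R) (n : nat) (xi : 'I_n -> {RV P >-> Xi})
    (F : 'I_n -> Xi -> R) :
  mutually_independent xi ->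
  (forall i, measurable_fun setT (F i)) -> (forall i z, 0 <= F i z) ->
  (forall i, (\int[P]_w (F i (xi i w))%:E)%E \is a fin_num) ->
  (\int[P]_w (\prod_(i < n) F i (xi i w))%:E
   = \prod_(i < n) \int[P]_w (F i (xi i w))%:E)%E.
Proof.
move=> indep.
have mxi i (g : Xi -> R) : measurable_fun setT g ->
    measurable_fun setT (g \o xi i).
  by move=> mg; apply: measurableT_comp => //; exact: measurable_funPT.
suff main (s : seq 'I_n) (B : 'I_n -> set Xi) (G : 'I_n -> Xi -> R) :
    (forall i, measurable (B i)) ->
    (forall i, i \notin s -> G i = \1_(B i)) ->
    (forall i, measurable_fun setT (G i)) -> (forall i z, 0 <= G i z) ->
    (forall i, (\int[P]_w (G i (xi i w))%:E)%E \is a fin_num) ->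
    (\int[P]_w (\prod_(i < n) G i (xi i w))%:E
     = \prod_(i < n) \int[P]_w (G i (xi i w))%:E)%E.
  move=> mF F0 Ffin; apply: (main (enum 'I_n) (fun=> setT)) => // i.
  by rewrite mem_enum.
elim: s B G => [|j s IHs] B G mB GB mG G0 Gfin.
  have {}GB i : G i = \1_(B i) by exact: GB.
  transitivity (\int[P]_w
      (\1_(\bigcap_(i in [set` [set: 'I_n]%SET]) (xi i @^-1` B i)) w)%:E)%E.
    apply: eq_integral => w _; congr (_%:E).
    under eq_bigr do rewrite GB.
    rewrite [RHS]indicE.
    have [h|/existsNP[i Ni]] := pselect (forall i, B i (xi i w)).
      rewrite mem_set => [|i _]; last exact: h.
      by rewrite big1// => i _; rewrite indicE mem_set.
    rewrite memNset => [|Bw]; last by apply: Ni; apply: Bw; rewrite /= inE.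
    by rewrite (bigD1 i)//= indicE memNset ?mul0r.
  rewrite integral_indic ?setIT//; last first.
    by apply: fin_bigcap_measurable => // i _; exact: measurable_preimage.
  apply: etrans (indep [set: 'I_n]%SET B (fun i _ => mB i)) _.
  apply: eq_big => [i|i _]; first by rewrite inE.
  by rewrite -integral_indic_comp//; apply: eq_integral => w _; rewrite GB.
(* [j] is the index released at this step. *)
pose c := (\prod_(i < n | i != j) \int[P]_w (G i (xi i w))%:E)%E.
pose H w := \prod_(i < n | i != j) G i (xi i w).
have mH : measurable_fun setT H.
  rewrite /H; under eq_fun do rewrite -big_filter.
  by apply: measurable_prod => i _; exact: mxi.
transitivity (\int[P]_w (H w * G j (xi j w))%:E)%E.
  by apply: eq_integral => w _; rewrite (bigD1 j)//= mulrC.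
rewrite (integral_weighted_comp (c := c))//.
- by rewrite [RHS](bigD1 j)//= muleC.
- by move=> w; apply: prodr_ge0.
- by rewrite /c; elim/big_ind : _ => // *; exact: fin_numM.
move=> C mC.
(* The induction hypothesis applies once the factor [j] is an indicator. *)
pose G' i : Xi -> R := if i == j then \1_C else G i.
pose B' i := if i == j then C else B i.
have G'j : G' j = \1_C by rewrite /G' eqxx.
have G'N i : i != j -> G' i = G i by rewrite /G' => /negPf ->.
have IG'j : (\int[P]_w (G' j (xi j w))%:E = P (xi j @^-1` C))%E.
  by rewrite -integral_indic_comp// G'j.
have mB' i : measurable (B' i) by rewrite /B'; case: ifPn.
have G'B i : i \notin s -> G' i = \1_(B' i).
  rewrite /G' /B' => si; case: ifPn => // ij.
  by apply: GB; rewrite inE negb_or ij.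
have mG' i : measurable_fun setT (G' i).
  by rewrite /G'; case: ifPn => // _; exact: measurable_indic.
have G'0 i z : 0 <= G' i z by rewrite /G'; case: ifPn.
have G'fin i : (\int[P]_w (G' i (xi i w))%:E)%E \is a fin_num.
  have [->|ij] := eqVneq i j; last by rewrite G'N.
  by rewrite IG'j fin_num_measure//; exact: measurable_preimage.
transitivity (\prod_(i < n) \int[P]_w (G' i (xi i w))%:E)%E; last first.
  rewrite (bigD1 j)//= IG'j muleC; congr (_ * _)%E.
  by apply: eq_bigr => i ij; rewrite G'N.
rewrite -(IHs B')//; apply: eq_integral => w _.
rewrite (bigD1 j)//= G'j mulrC; congr ((_ * _)%:E).
by apply: eq_bigr => i ij; rewrite G'N.
Qed.

(** * Quadratic majorants of the exponential *)

(** Power series comparison: for [k >= 2],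
    [u ^+ k <= u ^+ 2 * c ^+ (k - 2)] because [|u| <= c].  The remainder of order
    two of [expR u] is thus at most [u ^+ 2 / c ^+ 2] times that of [expR c]. *)
Lemma expR_le_quadratic (R : realType) (c u : R) : 0 < c -> `|u| <= c ->
  expR u <= 1 + u + (expR c - 1 - c) / c ^+ 2 * u ^+ 2.
Proof.
move=> c0 uc.
(* Coefficients of the series of the majorant; the corrections at ranks 0 and 1
   restore the affine part [1 + u]. *)
pose v : nat -> R := fun k =>
  u ^+ 2 / c ^+ 2 * (exp_coeff c k - (k == 0%N)%:R - c * (k == 1%N)%:R)
  + ((k == 0%N)%:R + u * (k == 1%N)%:R).
have coeff_le k : exp_coeff u k <= v k.
  rewrite /v /exp_coeff/=; case: k => [|[|k]].
  - by rewrite !expr0 divr1 subrr !mulr0 subr0 mulr0 add0r addr0.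
  - by rewrite !expr1 !divr1 subr0 !mulr1 subrr mulr0 !add0r.
  - rewrite /= !mulr0 !subr0 !addr0 -(addn2 k) !exprD.
    have -> : u ^+ 2 / c ^+ 2 * (c ^+ k * c ^+ 2 / (k + 2)`!%:R)
      = c ^+ k * u ^+ 2 / (k + 2)`!%:R.
      by field; rewrite pnatr_eq0 -lt0n fact_gt0 gt_eqF.
    rewrite ler_pM2r ?invr_gt0 ?ltr0n ?fact_gt0// ler_wpM2r ?sqr_ge0//.
    by rewrite (le_trans (ler_norm _))// normrX lerXn2r// nnegrE// ltW.
pose C := u ^+ 2 / c ^+ 2.
have series_v : \forall N \near \oo,
    C * (series (exp_coeff c) N - 1 - c) + (1 + u) = series v N.
  near=> N; rewrite /series/= /v big_split/= -mulr_sumr -/C.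
  have sum1 (a : R) j : (j < 2)%N -> \sum_(0 <= k < N) a * (k == j)%:R = a.
    move=> j2; have jN : (j < N)%N by apply: leq_trans j2 _; near: N; exists 2.
    rewrite big_mkord (bigD1 (Ordinal jN))//= eqxx mulr1 big1 ?addr0// => i ij.
    by rewrite (_ : (i == j :> nat) = false) ?mulr0//; apply/negbTE.
  have sum10 : \sum_(0 <= k < N) (k == 0%N)%:R = 1 :> R.
    by rewrite -[RHS](sum1 1 0%N)//; apply: eq_bigr => k _; rewrite mul1r.
  by rewrite 2!big_split/= !sumrN big_split/= !sum1// !sum10.
have -> : 1 + u + (expR c - 1 - c) / c ^+ 2 * u ^+ 2
    = C * (expR c - 1 - c) + (1 + u) by rewrite /C; ring.
have expR_cvg (t : R) : series (exp_coeff t) @ \oo --> expR t.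
  exact: is_cvg_series_exp_coeff.
apply: (ler_cvg_to (expR_cvg u)
   (g := fun N => C * (series (exp_coeff c) N - 1 - c) + (1 + u))).
- apply: cvgD; last exact: cvg_cst.
  apply: cvgMl_tmp; apply: cvgB; last exact: cvg_cst.
  by apply: cvgB; [exact: is_cvg_series_exp_coeff|exact: cvg_cst].
- near=> N; rewrite (near series_v N)//; apply: ler_sum => k _; exact: coeff_le.
Unshelve. all: by end_near. Qed.

Lemma fact_ge_2_3exp k : (2 * 3 ^ k <= (k.+2)`!)%N.
Proof.
elim: k => // k IHk; rewrite factS expnS mulnCA.
by apply: leq_mul => //.
Qed.

(** Since [2 * 3 ^ k <= (k + 2)!], the series of the left-hand side is dominated by
    the geometric series of ratio [c / 3]. *)
Lemma expR_quadratic_remainder_le (R : realType) (c : R) : 0 < c < 3 ->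
  (expR c - 1 - c) / c ^+ 2 <= (2 * (1 - c / 3))^-1.
Proof.
move=> /andP[c0 c3].
have q1 : 0 < 1 - c / 3 by lra.
rewrite ler_pdivrMr ?exprn_gt0//.
suff : expR c <= 1 + c + (2 * (1 - c / 3))^-1 * c ^+ 2 by lra.
apply: limr_le; first exact: is_cvg_series_exp_coeff.
near=> N.
have -> : N = (N.-2).+2.
  by rewrite -[in RHS]subn2 -addn2 subnK//; near: N; exists 2.
rewrite /series/= big_nat_recl// big_nat_recl//= /exp_coeff/= expr0 expr1 !divr1.
rewrite addrA lerD2l.
have term k : c ^+ k.+2 / (k.+2)`!%:R <= c ^+ 2 / 2 * (c / 3) ^+ k.
  rewrite -[k.+2]addn2 exprD expr_div_n mulrC.
  have -> : c ^+ 2 / 2 * (c ^+ k / 3 ^+ k) = (2 * 3 ^+ k)^-1 * (c ^+ k * c ^+ 2).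
    by field; rewrite expf_neq0.
  rewrite ler_pM2r; last by rewrite mulr_gt0 ?exprn_gt0.
  rewrite lef_pV2 ?posrE ?mulr_gt0 ?exprn_gt0 ?ltr0n ?fact_gt0//.
  by rewrite addn2 -natrX -natrM ler_nat fact_ge_2_3exp.
apply: (@le_trans _ _ (\sum_(0 <= k < N.-2) c ^+ 2 / 2 * (c / 3) ^+ k)).
  by apply: ler_sum => k _; exact: term.
rewrite -mulr_sumr invfM -mulrA mulrC mulrAC.
rewrite [leLHS](_ : _ = 2^-1 * (\sum_(0 <= k < N.-2) (c / 3) ^+ k) * c ^+ 2);
  last by ring.
rewrite mulrC [leRHS]mulrC ler_pM2l ?exprn_gt0// ler_pM2l ?invr_gt0//.
rewrite -[leRHS]mul1r ler_pdivlMr// big_mkord.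
rewrite [leLHS](_ : _ = 1 - (c / 3) ^+ N.-2); last first.
  by have := subrX1 (c / 3) N.-2; lra.
by rewrite gerBl exprn_ge0// divr_ge0// ltW.
Unshelve. all: by end_near. Qed.

(** * Moment generating functions *)

Lemma ae_bounded_integrable (d : measure_display) (Omega : measurableType d)
    (R : realType) (P : probability Omega R) (Y : Omega -> R) (b : R) :
  measurable_fun setT Y -> (\forall w \ae P, `|Y w| <= b) ->
  P.-integrable setT (EFin \o Y).
Proof.
move=> mY Yb; apply/integrableP; split; first exact/measurable_EFinP.
have : (\int[P]_w `|(EFin \o Y) w| <= \int[P]_w (`|b|)%:E)%E.
  apply: ae_ge0_le_integral => //.
  - by apply: measurableT_comp => //; exact/measurable_EFinP.
  - by move: Yb; apply: filterS => w Yw _; rewrite lee_fin (le_trans Yw)// ler_norm.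
by move=> /le_lt_trans; apply; rewrite integral_cst//= probability_setT mule1 ltry.
Qed.

Lemma ae_le_integral (d : measure_display) (Omega : measurableType d)
    (R : realType) (mu : {measure set Omega -> \bar R}) (f g : Omega -> \bar R) :
  mu.-integrable setT f -> mu.-integrable setT g ->
  (\forall w \ae mu, (f w <= g w)%E) ->
  (\int[mu]_w f w <= \int[mu]_w g w)%E.
Proof.
move=> intf intg [N [mN muN0 fgN]].
have mNC : measurable (setT `\` N) by exact: measurableD.
rewrite (negligible_integral mN measurableT intf muN0).
rewrite (negligible_integral mN measurableT intg muN0).
apply: le_integral => //; [exact: integrableS intf|exact: integrableS intg|].
move=> w /set_mem[_ Nw]; apply: contrapT => fgw; exact/Nw/fgN.
Qed.

(** Integrating the quadratic majorant of [expR (t * Y)] kills its linear term,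
    and [1 + a <= expR a] puts the result in a form that multiplies well over
    independent copies. *)
Lemma mgf_le (d : measure_display) (Omega : measurableType d)
    (R : realType) (P : probability Omega R) (Y : Omega -> R) (b v t : R) :
  measurable_fun setT Y -> 0 < b -> 0 < t ->
  (\forall w \ae P, `|Y w| <= b) ->
  (\int[P]_w (Y w)%:E = 0)%E ->
  (\int[P]_w (Y w ^+ 2)%:E <= v%:E)%E ->
  (\int[P]_w (expR (t * Y w))%:E
   <= (expR ((expR (t * b) - 1 - t * b) / (t * b) ^+ 2 * t ^+ 2 * v))%:E)%E.
Proof.
move=> mY b0 t0 Yb EY EY2.
set K := (_ / _); have K0 : 0 <= K.
  rewrite divr_ge0 ?sqr_ge0// -addrA -opprD subr_ge0.
  exact: expR_ge1Dx.
have mtY : measurable_fun setT (fun w => t * Y w).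
  exact: measurable_funM.
have intY := ae_bounded_integrable mY Yb.
have intY2 : P.-integrable setT (EFin \o (fun w => Y w ^+ 2)).
  apply: (ae_bounded_integrable (b := b ^+ 2)); first exact: measurable_funX.
  move: Yb; apply: filterS => w Yw.
  by rewrite normrX lerXn2r// nnegrE// ltW.
have inte : P.-integrable setT (EFin \o (fun w => expR (t * Y w))).
  apply: (ae_bounded_integrable (b := expR (t * b))).
    exact: measurableT_comp.
  move: Yb; apply: filterS => w Yw.
  rewrite ger0_norm ?expR_ge0// ler_expR ler_pM2l//.
  by rewrite (le_trans _ Yw)// ler_norm.
pose g w := (1%:E + (t%:E * (Y w)%:E + (K * t ^+ 2)%:E * (Y w ^+ 2)%:E))%E.
have int1 : P.-integrable setT (fun w => t%:E * (Y w)%:E)%E.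
  exact: (integrableZl measurableT t intY).
have int2 : P.-integrable setT (fun w => (K * t ^+ 2)%:E * (Y w ^+ 2)%:E)%E.
  exact: (integrableZl measurableT _ intY2).
have int0 : P.-integrable setT (fun=> 1%:E : \bar R).
  by apply: finite_measure_integrable_cst.
have int12 := integrableD measurableT int1 int2.
have intg := integrableD measurableT int0 int12.
apply: (@le_trans _ _ (\int[P]_w g w)%E).
  apply: ae_le_integral => //.
  move: Yb; apply: filterS => w Yw.
  rewrite /g -!EFinM -!EFinD lee_fin.
  apply: le_trans (expR_le_quadratic (c := t * b) _ _) _.
  - exact: mulr_gt0.
  - by rewrite normrM gtr0_norm// ler_pM2l.
  by rewrite -/K exprMn !mulrA !addrA.
rewrite integralD// integralD// (integralZl _ intY)// EY mule0 add0e.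
rewrite (integralZl _ intY2)// integral_cst//= probability_setT mule1.
apply: (@le_trans _ _ (1 + (K * t ^+ 2)%:E * v%:E)%E).
  by rewrite leeD2l// lee_wpmul2l// lee_fin mulr_ge0// sqr_ge0.
by rewrite -EFinM -EFinD lee_fin expR_ge1Dx.
Qed.

Lemma integral_identically_distributed (d d' : measure_display)
    (Omega : measurableType d) (Xi : measurableType d') (R : realType)
    (P : probability Omega R) (n : nat) (xi : 'I_n -> {RV P >-> Xi})
    (f : Xi -> R) (i j : 'I_n) :
  identically_distributed xi -> measurable_fun setT f -> (forall z, 0 <= f z) ->
  (\int[P]_w (f (xi i w))%:E = \int[P]_w (f (xi j w))%:E)%E.
Proof.
move=> idd mf f0.
have dE k : (\int[P]_w (f (xi k w))%:E
    = \int[distribution P (xi k)]_z (f z)%:E)%E.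
  apply/esym/ge0_integral_distribution; first exact/measurable_EFinP.
  by move=> z; rewrite lee_fin.
rewrite (dE i) (dE j); apply: eq_measure_integral => A mA _; exact: idd.
Qed.

(** * Bernstein's inequality *)

(** The moment generating function of the sum is the [n]-th power of that of one
    term, by independence and equality in distribution; hypotheses on a single
    index [i0] therefore suffice. *)
Lemma chernoff_iid (d d' : measure_display)
    (Omega : measurableType d) (Xi : measurableType d') (R : realType)
    (P : probability Omega R) (n : nat) (xi : 'I_n -> {RV P >-> Xi})
    (i0 : 'I_n) (h : Xi -> R) (b v s t : R) :
  iid xi -> measurable_fun setT h -> 0 < b -> 0 < t ->
  (\forall w \ae P, `|h (xi i0 w)| <= b) ->
  (\int[P]_w (h (xi i0 w))%:E = 0)%E ->
  (\int[P]_w (h (xi i0 w) ^+ 2)%:E <= v%:E)%E ->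
  (P [set w | (s <= \sum_(i < n) h (xi i w))%R]
   <= (expR (n%:R * ((expR (t * b) - 1 - t * b) / (t * b) ^+ 2 * t ^+ 2 * v)
             - t * s))%:E)%E.
Proof.
move=> [indep idd] mh b0 t0 hb Eh Eh2.
have mhxi i : measurable_fun setT (fun w => h (xi i w)).
  by apply: measurableT_comp => //; exact: measurable_funPT.
pose S w := \sum_(i < n) h (xi i w).
have mS : measurable_fun setT S by exact: measurable_sum.
pose X : {RV P >-> R} := HB.pack S (isMeasurableFun.Build _ _ _ _ S mS).
set e := _ / _ * _ * _.
pose F z := expR (t * h z).
have mF : measurable_fun setT F.
  by apply: measurableT_comp => //; exact: measurable_funM.
have F0 z : 0 <= F z by exact: expR_ge0.
have F_le : (\int[P]_w (F (xi i0 w))%:E <= (expR e)%:E)%E by exact: mgf_le.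
have F_ge : (0 <= \int[P]_w (F (xi i0 w))%:E)%E.
  by apply: integral_ge0 => w _; rewrite lee_fin.
have FE i : (\int[P]_w (F (xi i w))%:E = (fine (\int[P]_w (F (xi i0 w))%:E))%:E)%E.
  rewrite fineK; first exact: integral_identically_distributed.
  by rewrite ge0_fin_numE// (le_lt_trans F_le)// ltry.
apply: le_trans (chernoff X s t0) _.
rewrite expRD EFinM; apply: lee_wpmul2r.
  by rewrite lee_fin expR_ge0.
rewrite /mmt_gen_fun unlock.
rewrite [leLHS](_ : _ = (\int[P]_w (\prod_(i < n) F (xi i w))%:E)%E); last first.
  apply: eq_integral => w _; congr (_%:E).
  by rewrite /= -expR_sum -mulr_sumr mulrC.
rewrite (expectation_prod_independent (F := fun=> F))//; last by move=> i; rewrite FE.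
under eq_bigr do rewrite FE.
rewrite prodEFin prodr_const card_ord expRM_natl lee_fin lerXn2r ?nnegrE//.
- by rewrite fine_ge0.
- by rewrite -lee_fin -(FE i0).
Qed.

(** The exponent of [chernoff_iid] is optimized in [t].  After bounding the
    quadratic remainder by [(2 * (1 - t * b / 3))^-1], the choice
    [t = (b / 3 + mu)^-1] with [mu ^+ 2 = n * v / (2 * x)] makes the exponent
    equal to [- x].  This needs [v] and [x] positive, so the two degenerate cases
    are treated apart. *)
Lemma bernstein_iid (d d' : measure_display)
    (Omega : measurableType d) (Xi : measurableType d') (R : realType)
    (P : probability Omega R) (n : nat) (xi : 'I_n -> {RV P >-> Xi})
    (i0 : 'I_n) (h : Xi -> R) (b v x : R) :
  iid xi -> measurable_fun setT h -> 0 < b -> 0 <= v -> 0 <= x ->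
  (\forall w \ae P, `|h (xi i0 w)| <= b) ->
  (\int[P]_w (h (xi i0 w))%:E = 0)%E ->
  (\int[P]_w (h (xi i0 w) ^+ 2)%:E <= v%:E)%E ->
  (P [set w | (Num.sqrt (2 * n%:R * v * x) + b / 3 * x
               <= \sum_(i < n) h (xi i w))%R] <= (expR (- x))%:E)%E.
Proof.
move=> iidxi mh b0 v0 x0 hb Eh Eh2.
have tail s t (t0 : 0 < t) := chernoff_iid s iidxi mh b0 t0 hb Eh Eh2.
have n0 : 0 < n%:R :> R by rewrite ltr0n (leq_ltn_trans _ (ltn_ord i0)).
move: x0; rewrite le_eqVlt => /predU1P[<-|x0].
  rewrite oppr0 expR0; apply: probability_le1.
  rewrite -[X in measurable X]setTI.
  apply: measurable_fun_le => //; apply: measurable_sum => i.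
  by apply: measurableT_comp => //; exact: measurable_funPT.
move: v0; rewrite le_eqVlt => /predU1P[v0|v0].
  (* [t = 3 / b] is the limit of the general choice as [mu] tends to 0. *)
  have t0 : 0 < 3 / b by rewrite divr_gt0.
  apply: le_trans (tail _ _ t0) _; rewrite lee_fin ler_expR -v0.
  rewrite !mulr0 mul0r sqrtr0 !add0r lerN2.
  by rewrite [leRHS](_ : _ = x)//; field; rewrite gt_eqF.
pose mu := Num.sqrt (n%:R * v / (2 * x)).
have mu2 : mu ^+ 2 = n%:R * v / (2 * x).
  by rewrite sqr_sqrtr// divr_ge0 ?mulr_ge0// ltW.
have mu0 : 0 < mu by rewrite sqrtr_gt0 divr_gt0 ?mulr_gt0.
have -> : Num.sqrt (2 * n%:R * v * x) = 2 * x * mu.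
  rewrite -[RHS]gtr0_norm ?mulr_gt0// -sqrtr_sqr exprMn mu2; congr Num.sqrt.
  by field; rewrite gt_eqF.
pose t := (b / 3 + mu)^-1.
have t0 : 0 < t by rewrite invr_gt0 addr_gt0// divr_gt0.
(* Hence [1 - t * b / 3 = t * mu]. *)
have tE : t * (b / 3) + t * mu = 1.
  by rewrite -mulrDr mulVf// gt_eqF// addr_gt0// divr_gt0.
have tmu0 : 0 < t * mu by rewrite mulr_gt0.
apply: le_trans (tail _ _ t0) _; rewrite lee_fin ler_expR.
have tb : 0 < t * b < 3 by rewrite mulr_gt0//=; lra.
have := expR_quadratic_remainder_le tb.
set phi := (_ / _) => phi_le.
have {}phi_le : phi <= (2 * (t * mu))^-1.
  by apply: le_trans phi_le _; rewrite lef_pV2 ?posrE ?mulr_gt0//; lra.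
have : n%:R * (phi * t ^+ 2 * v) <= t * (x * mu).
  apply: (@le_trans _ _ (n%:R * ((2 * (t * mu))^-1 * t ^+ 2 * v))).
    rewrite ler_pM2l// ler_pM2r// ler_pM2r ?exprn_gt0//.
  have nv : n%:R * v = 2 * x * mu ^+ 2.
    by rewrite mu2; field; rewrite gt_eqF.
  rewrite [leLHS](_ : _ = (n%:R * v) * ((2 * (t * mu))^-1 * t ^+ 2)); last by ring.
  rewrite nv [leLHS](_ : _ = t * (x * mu))//.
  by field; rewrite !gt_eqF.
have : x = x * (t * (b / 3)) + x * (t * mu) by rewrite -mulrDr tE mulr1.
nra.
Qed.

Lemma bernstein_iid_abs (d d' : measure_display)
    (Omega : measurableType d) (Xi : measurableType d') (R : realType)
    (P : probability Omega R) (n : nat) (xi : 'I_n -> {RV P >-> Xi})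
    (i0 : 'I_n) (h : Xi -> R) (b v x : R) :
  iid xi -> measurable_fun setT h -> 0 < b -> 0 <= v -> 0 <= x ->
  (\forall w \ae P, `|h (xi i0 w)| <= b) ->
  (\int[P]_w (h (xi i0 w))%:E = 0)%E ->
  (\int[P]_w (h (xi i0 w) ^+ 2)%:E <= v%:E)%E ->
  (P [set w | (Num.sqrt (2 * n%:R * v * x) + b / 3 * x
               <= `|\sum_(i < n) h (xi i w)|)%R] <= (2 * expR (- x))%:E)%E.
Proof.
move=> iidxi mh b0 v0 x0 hb Eh Eh2; set s := _ + _.
have upper := bernstein_iid iidxi mh b0 v0 x0 hb Eh Eh2.
have mNh : measurable_fun setT (fun z => - h z) by exact: measurableT_comp.
have lower : (P [set w | (s <= \sum_(i < n) - h (xi i w))%R] <= (expR (- x))%:E)%E.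
  apply: (bernstein_iid (i0 := i0) (h := fun z => - h z)) => //.
  - by move: hb; apply: filterS => w; rewrite normrN.
  - under eq_integral do rewrite EFinN.
    rewrite integralN ?Eh ?oppe0//=; apply: integrable_add_def => //.
    apply: (ae_bounded_integrable (b := b)) => //.
    by apply: measurableT_comp => //; exact: measurable_funPT.
  - by under eq_integral do rewrite sqrrN.
have msum (g : Xi -> R) : measurable_fun setT g ->
    measurable [set w | s <= \sum_(i < n) g (xi i w)].
  move=> mg; rewrite -[X in measurable X]setTI.
  apply: measurable_fun_le => //; apply: measurable_sum => i.
  by apply: measurableT_comp => //; exact: measurable_funPT.
apply: (@le_trans _ _ (P ([set w | (s <= \sum_(i < n) h (xi i w))%R]
    `|` [set w | (s <= \sum_(i < n) - h (xi i w))%R]))).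
  apply: le_measure.
  - apply/mem_set; rewrite -[X in measurable X]setTI.
    apply: measurable_fun_le => //; apply: measurableT_comp => //.
    apply: measurable_sum => i.
    by apply: measurableT_comp => //; exact: measurable_funPT.
  - by apply/mem_set/measurableU; [exact: msum|exact: msum mNh].
  - move=> w /=; rewrite sumrN; case: (ger0P (\sum_(i < n) h (xi i w))) => _ sle.
      by left.
    by right.
apply: le_trans (measureU2 _ _ _) _; [exact: msum|exact: msum mNh|].
by rewrite mulrDl mul1r EFinD leeD.
Qed.

(** The event that all [g (xi i)] are negative is empty, and by independence its
    probability is the [n]-th power of that of [g (xi i0) < 0]. *)
Lemma ae_nonneg_of_sum_nonneg (d d' : measure_display)
    (Omega : measurableType d) (Xi : measurableType d') (R : realType)
    (P : probability Omega R) (n : nat) (xi : 'I_n -> {RV P >-> Xi})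
    (i0 : 'I_n) (g : Xi -> R) :
  iid xi -> measurable_fun setT g ->
  (forall w, 0 <= \sum_(i < n) g (xi i w)) ->
  \forall w \ae P, 0 <= g (xi i0 w).
Proof.
move=> [indep idd] mg sum_ge0.
pose B : set Xi := [set z | g z < 0].
have mB : measurable B.
  rewrite (_ : B = setT `&` g @^-1` `]-oo, 0[%classic); first exact: mg.
  by rewrite setTI; apply/seteqP; split => z /=; rewrite in_itv.
have PE i : P (xi i @^-1` B) = P (xi i0 @^-1` B) by exact: idd.
have cap0 : \bigcap_(i in [set` [set: 'I_n]%SET]) (xi i @^-1` B) = set0.
  apply/seteqP; split => // w Bw.
  have : \sum_(i < n) g (xi i w) < 0.
    rewrite (bigD1 i0)//= -[ltRHS]addr0 ltr_leD//.
      by apply: (Bw i0); rewrite /= inE.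
    by apply: sumr_le0 => i _; apply/ltW/(Bw i); rewrite /= inE.
  by rewrite ltNge sum_ge0.
have prod0 := indep [set: 'I_n]%SET (fun=> B) (fun i _ => mB).
rewrite cap0 measure0 in prod0.
have PB0 : P (xi i0 @^-1` B) = 0%E.
  have Pfin : P (xi i0 @^-1` B) = (fine (P (xi i0 @^-1` B)))%:E.
    by rewrite fineK// fin_num_measure//; exact: measurable_preimage.
  move: prod0; under eq_bigr do rewrite PE Pfin.
  rewrite prodEFin prodr_const => -[/esym/eqP].
  rewrite expf_eq0 => /andP[_ /eqP P0].
  by rewrite Pfin P0.
exists (xi i0 @^-1` B); split => //; first exact: measurable_preimage.
by move=> w /= /negP; rewrite -ltNge.
Qed.

(** * Penalized selection *)

(** The minimality of [m0] against [m] reads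
    [(1 - C) * p2 m0 >= (1 - C) * p2 m + Risk (sm m0) - Risk (sm m)
     - (delta m0 - delta m)].
    The excess risk of [m0] then occurs with coefficient [1 - eps >= 0] and can be
    dropped, that of [m] with coefficient at most [2]. *)
Lemma p2_argmin_ge (R : realType) (Omega S M : Type) (Risk : S -> R)
    (Rn : S -> Omega -> R) (sstar : S) (sm : M -> S) (shat : M -> Omega -> S)
    (pen : M -> R) (w : Omega) (eps eps' C : R) (m0 m : M) :
  (forall m, Risk sstar <= Risk (sm m)) ->
  (forall m, pen m = p2 Rn sm shat w m) ->
  delta_increments_bound Risk Rn sstar sm w eps eps' ->
  eps <= 1 -> C < 1 ->
  argmin (fun m => Rn (shat m w) w + C * pen m) m0 ->
  p2 Rn sm shat w m - 2 / (1 - C) * (Risk (sm m) - Risk sstar) - eps' / (1 - C)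
    <= p2 Rn sm shat w m0.
Proof.
move=> Risk_ge penE dbound eps1 C1 m0_min.
have C1' : 0 < 1 - C by rewrite subr_gt0.
rewrite -(ler_pM2l C1') [leLHS](_ : _ = (1 - C) * p2 Rn sm shat w m
    - 2 * (Risk (sm m) - Risk sstar) - eps'); last by field; rewrite gt_eqF.
have slack_ge0 : 0 <= (1 - eps) * (Risk (sm m0) - Risk sstar
    + (Risk (sm m) - Risk sstar)).
  by rewrite mulr_ge0 ?subr_ge0// addr_ge0// subr_ge0.
have := m0_min m; have := dbound m0 m.
rewrite /= !penE /delta /p2 ler_norml => /andP[_ dle] mle.
lra.
Qed.

(** Both [g - g0] and [r - r0] lie in [[-A, A]] when [g] and [g0] take values in
    [[0, A]], so the centred variable is bounded by [2 * A] instead of the [4 * A]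
    that [|g|, |g0| <= A] would give. *)
Lemma excess_risk_deviation (R : realType) (d d' : measure_display)
    (Omega : measurableType d) (Xi : measurableType d')
    (P : probability Omega R) (n : nat) (xi : 'I_n -> {RV P >-> Xi})
    (i0 : 'I_n) (g g0 : Xi -> R) (r r0 A v x : R) :
  iid xi -> measurable_fun setT g -> measurable_fun setT g0 ->
  0 < A -> 0 <= v -> 0 <= x ->
  (\forall w \ae P, 0 <= g (xi i0 w) <= A) ->
  (\forall w \ae P, 0 <= g0 (xi i0 w) <= A) ->
  ('E_P[fun w => g (xi i0 w)] = r%:E)%E ->
  ('E_P[fun w => g0 (xi i0 w)] = r0%:E)%E ->
  ('V_P[fun w => (g (xi i0 w) - g0 (xi i0 w))%R] <= v%:E)%E ->
  (P [set w | (Num.sqrt (2 * n%:R * v * x) + 2 * A / 3 * x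
       <= `|\sum_(i < n) (g (xi i w) - g0 (xi i w) - (r - r0))|)%R]
   <= (2 * expR (- x))%:E)%E.
Proof.
move=> iidxi mg mg0 A0 v0 x0 gA g0A Eg Eg0 Vg.
have mxi (f : Xi -> R) : measurable_fun setT f ->
    measurable_fun setT (fun w => f (xi i0 w)).
  by move=> mf; apply: measurableT_comp => //; exact: measurable_funPT.
have integrable_f (f : Xi -> R) : measurable_fun setT f ->
    (\forall w \ae P, 0 <= f (xi i0 w) <= A) ->
    P.-integrable setT (EFin \o (fun w => f (xi i0 w))).
  move=> mf fA; apply: (ae_bounded_integrable (b := A) (mxi _ mf)).
  by move: fA; apply: filterS => w /andP[? ?]; rewrite ger0_norm.
have risk_bound (f : Xi -> R) (q : R) : measurable_fun setT f ->
    (\forall w \ae P, 0 <= f (xi i0 w) <= A) ->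
    ('E_P[fun w => f (xi i0 w)] = q%:E)%E -> 0 <= q <= A.
  move=> mf fA; rewrite unlock => Ef.
  have intf := integrable_f _ mf fA.
  have intc (c : R) : P.-integrable setT (fun=> c%:E : \bar R).
    by apply: finite_measure_integrable_cst.
  have intcE (c : R) : (\int[P]_w c%:E = c%:E)%E.
    by rewrite integral_cst//= probability_setT mule1.
  apply/andP; split; rewrite -lee_fin -Ef -intcE.
    apply: (ae_le_integral (intc 0) intf).
    by move: fA; apply: filterS => w /andP[? _]; rewrite lee_fin.
  apply: (ae_le_integral intf (intc A)).
  by move: fA; apply: filterS => w /andP[_ ?]; rewrite lee_fin.
have /andP[r_ge0 rA] := risk_bound _ _ mg gA Eg.
have /andP[r0_ge0 r0A] := risk_bound _ _ mg0 g0A Eg0.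
pose h z := g z - g0 z - (r - r0).
have mh : measurable_fun setT h.
  by apply: measurable_funB => //; exact: measurable_funB.
have intg := integrable_f _ mg gA.
have intg0 := integrable_f _ mg0 g0A.
have Edif : ('E_P[fun w => (g (xi i0 w) - g0 (xi i0 w))%R] = (r - r0)%:E)%E.
  move: Eg Eg0; rewrite unlock => Eg Eg0.
  under eq_integral do rewrite EFinB.
  by rewrite integralB// Eg Eg0.
apply: (bernstein_iid_abs (i0 := i0) (h := h)) => //.
- by rewrite mulr_gt0.
- move: gA g0A; apply: filterS2 => w /andP[? ?] /andP[? ?].
  by rewrite /h ler_norml; lra.
- transitivity (\int[P]_w ((g (xi i0 w) - g0 (xi i0 w))%:E - (r - r0)%:E))%E.
    by apply: eq_integral => w _; rewrite -EFinB.
  rewrite integralB//=; last 2 first.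
  - exact: integrableB intg intg0.
  - by apply: finite_measure_integrable_cst.
  move: Edif; rewrite unlock => ->.
  by rewrite integral_cst//= probability_setT mule1 subee.
- move: Vg; rewrite /variance covariance.unlock Edif/= expectation.unlock.
  by under eq_integral do rewrite /= -expr2.
Qed.

Theorem proposition1
  (R : realType) (d : measure_display) (Omega : measurableType d)
  (P : probability Omega R)
  (S : Type) (M : finType)
  (Risk : S -> R) (Rn : S -> {RV P >-> R})
  (sstar : S) (sm : M -> S) (shat : M -> Omega -> S)
  (pen0 : Omega -> M -> R) (mhat : R -> Omega -> M)
  (Risk_ge0 : forall t, 0 <= Risk t)
  (Rn_ge0 : forall t w, 0 <= Rn t w)
  (Rn_mean : forall t, ('E_P[Rn t] = (Risk t)%:E)%E)
  (sstar_inf : Risk sstar = inf (range Risk))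
  (mhat_argmin : forall (C : R) (w : Omega), 0 <= C ->
     argmin (fun m => Rn (shat m w) w + C * pen0 w m) (mhat C w)) :
  (* part (i) *)
  (forall (w : Omega) (eps eps' : R),
     0 <= eps <= 1 -> 0 <= eps' ->
     (forall m, pen0 w m = p2 Rn sm shat w m) ->
     delta_increments_bound Risk Rn sstar sm w eps eps' ->
     (forall C : R, 0 <= C < 1 ->
        p2 Rn sm shat w (mhat C w) >=
          sup (range (fun m : M => p2 Rn sm shat w m
                 - 2 / (1 - C) * (Risk (sm m) - Risk sstar)))
          - eps' / (1 - C))
     /\
     (forall m1 : M, Risk (sm m1) = Risk sstar -> 0 < p2 Rn sm shat w m1 ->
        forall alpha : R, 0 < alpha < 1 ->
        let eta := eps' / (alpha * p2 Rn sm shat w m1) in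
        forall C : R, 0 <= C < 1 -> C <= 1 - eta ->
          p2 Rn sm shat w (mhat C w) >= (1 - alpha) * p2 Rn sm shat w m1))
  /\
  (* part (ii) *)
  (forall (n : nat) (n_gt0 : (0 < n)%N)
     (d' : measure_display) (Xi : measurableType d')
     (xi : 'I_n -> {RV P >-> Xi}) (gamma : Xi -> S -> R) (A L : R),
     let xi1 := xi (Ordinal n_gt0) in
     iid xi ->
     (forall t, measurable_fun [set: Xi] (fun z => gamma z t)) ->
     0 < A -> 0 < L ->
     (forall t w, Rn t w = n%:R^-1 * \sum_(i < n) gamma (xi i w) t) ->
     (forall t, ('E_P[fun w => gamma (xi1 w) t] = (Risk t)%:E)%E) ->
     (forall t, \forall w \ae P, `| gamma (xi1 w) t | <= A) ->
     (forall m, ('V_P[fun w => (gamma (xi1 w) (sm m) - gamma (xi1 w) sstar)%R]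
                 <= (L * (Risk (sm m) - Risk sstar))%:E)%E) ->
     forall x : R, 0 <= x ->
       with_probability_at_least P (1 - 2 * #|M|%:R * expR (- x))
         (fun w => forall theta : R, 0 < theta ->
            delta_increments_bound Risk Rn sstar sm w
              theta ((L / theta + 4 * A / 3) * (x / n%:R)))).
Proof.
have Risk_ge t : Risk sstar <= Risk t.
  rewrite sstar_inf; apply: ge_inf; last by exists t.
  by exists 0 => _ [t' _ <-].
split.
  move=> w eps eps' /andP[eps0 eps1] eps'0 penE dbound.
  have key (C : R) m : 0 <= C < 1 -> p2 Rn sm shat w m
      - 2 / (1 - C) * (Risk (sm m) - Risk sstar) - eps' / (1 - C)
      <= p2 Rn sm shat w (mhat C w).
    move=> /andP[C0 C1].
    apply: (p2_argmin_ge (Rn := Rn) (pen := pen0 w) (eps := eps)) => //.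
    exact: mhat_argmin.
  split=> [C C01|m1 m1_opt p2_gt0 alpha /andP[alpha0 alpha1] eta C C01 Ceta].
    rewrite lerBlDr; apply: ge_sup.
      by apply: image_nonempty; exists (mhat C w).
    by move=> _ [m _ <-]; rewrite -lerBlDr; exact: key.
  have /andP[_ C1] := C01.
  have C1' : 0 < 1 - C by rewrite subr_gt0.
  apply: le_trans (key C m1 C01); rewrite m1_opt subrr mulr0 subr0 mulrBl mul1r.
  rewrite lerD2l lerN2 ler_pdivrMr//.
  have eta_le : eta <= 1 - C by lra.
  have a0 : 0 < alpha * p2 Rn sm shat w m1 by rewrite mulr_gt0.
  by move: eta_le; rewrite /eta ler_pdivrMr// mulrC.
move=> n n_gt0 d' Xi xi gamma A L xi1 iidxi mgamma A0 L0 RnE gamma_mean.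
move=> gamma_bd gamma_var x x0.
have n0 : 0 < n%:R :> R by rewrite ltr0n.
have gamma_ge0 t : \forall w \ae P, 0 <= gamma (xi1 w) t.
  apply: (ae_nonneg_of_sum_nonneg (Ordinal n_gt0) iidxi (mgamma t)).
  move=> w; have := Rn_ge0 t w.
  by rewrite RnE pmulr_rge0// invr_gt0.
have gamma_itv t : \forall w \ae P, 0 <= gamma (xi1 w) t <= A.
  move: (gamma_ge0 t) (gamma_bd t); apply: filterS2 => w g0 gA.
  by rewrite g0 (le_trans (ler_norm _)).
pose l m := Risk (sm m) - Risk sstar.
have l0 m : 0 <= l m by rewrite subr_ge0.
(* [s m] is Bernstein's threshold for the sum [T m], with variance bound [L * l m]. *)
pose s m := Num.sqrt (2 * n%:R * (L * l m) * x) + 2 * A / 3 * x.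
pose T m w := \sum_(i < n) (gamma (xi i w) (sm m) - gamma (xi i w) sstar - l m).
pose bad m := [set w | s m <= `|T m w|].
have mT m : measurable_fun setT (T m).
  apply: measurable_sum => i; apply: measurable_funB => //.
  by apply: measurable_funB; apply: (measurableT_comp (mgamma _));
    exact: measurable_funPT.
have mbad m : measurable (bad m).
  rewrite -[X in measurable X]setTI.
  by apply: measurable_fun_le => //; exact: measurableT_comp.
have Pbad m : (P (bad m) <= (2 * expR (- x))%:E)%E.
  apply: (excess_risk_deviation (i0 := Ordinal n_gt0)
    (g := fun z => gamma z (sm m)) (g0 := fun z => gamma z sstar)) => //.
  by rewrite mulr_ge0// ltW.
pose bads := \bigcup_(m in [set` enum M]) bad m.
have [mbads Pbads] : measurable bads /\
    (P bads <= (2 * #|M|%:R * expR (- x))%:E)%E.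
  have -> : 2 * #|M|%:R * expR (- x) = (size (enum M))%:R * (2 * expR (- x)).
    by rewrite -cardE; ring.
  rewrite /bads bigcup_seq; elim: (enum M) => [|m r [mr Pr]].
    by rewrite big_nil measure0 mul0r.
  rewrite big_cons; split; first exact: measurableU.
  apply: le_trans (measureU2 _ _ _) _ => //.
  by rewrite /= -addn1 natrD addrC mulrDl mul1r EFinD leeD.
exists (~` bads); split.
- exact: measurableC.
- rewrite probability_setC// EFinB leeB//.
move=> w good theta theta0 m m'.
have T_lt k : `|T k w| < s k.
  rewrite ltNge; apply/negP => bad_k; apply: good.
  by exists k => //=; rewrite mem_enum.
have TE k : T k w = n%:R * (Rn (sm k) w - Rn sstar w - l k).
  rewrite /T !RnE sumrB [X in X - _]sumrB sumr_const card_ord -(mulr_natl (l k)).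
  by field; rewrite gt_eqF.
have s_le k : s k <= n%:R * theta * l k + L * x / (2 * theta) + 2 * A / 3 * x.
  rewrite lerD2r.
  (* [2 * sqrt (a * b) <= a + b] for [a = n theta l] and [b = L x / (2 theta)]. *)
  have c0 : 0 <= n%:R * theta * l k + L * x / (2 * theta).
    by rewrite addr_ge0// ?divr_ge0// ?mulr_ge0// ltW.
  rewrite -[leRHS]ger0_norm// -sqrtr_sqr ler_wsqrtr//.
  rewrite -subr_ge0 [leRHS](_ : _ =
    (n%:R * theta * l k - L * x / (2 * theta)) ^+ 2) ?sqr_ge0//.
  by field; rewrite gt_eqF.
rewrite -(ler_pM2l n0) -[X in X * `|_|]gtr0_norm// -normrM.
have -> : n%:R * (delta Risk Rn sm w m - delta Risk Rn sm w m') = T m' w - T m w.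
  by rewrite !TE /delta /l; ring.
apply: le_trans (ler_normB _ _) _.
apply: le_trans (lerD (ltW (T_lt _)) (ltW (T_lt _))) _.
apply: le_trans (lerD (s_le _) (s_le _)) _.
rewrite le_eqVlt; apply/orP; left; apply/eqP; rewrite /l.
by field; rewrite !gt_eqF.
Qed.
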